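(* Let $Z \in \mathbb{Q}^{3\times 3}$ be a skew-symmetric quaternion matrix. If $Z$ is invertible, then its inverse $Z^{-1}$ is not a skew-symmetric matrix.
   Context: $\mathbb{Q}$ denotes the (noncommutative) real quaternions. For a quaternion matrix $A = (a_{ij})$, the transpose is $A^\top = (a_{ji})$ (no conjugation). A square quaternion matrix $Z$ is skew-symmetric if $Z^\top = -Z$. A matrix $A \in \mathbb{Q}^{n\times n}$ is invertible if $AB = BA = I$ for some $B \in \mathbb{Q}^{n\times n}$, in which case $A^{-1} = B$. *)

(* Defs.v *)
From HB Require Import structures.
From mathcomp Require Import all_boot all_order all_algebra.
From mathcomp Require Import ring.
From mathcomp Require Import reals.

Set Implicit Arguments.
Unset Strict Implicit.
Unset Printing Implicit Defensive.

Import GRing.Theory.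
Local Open Scope ring_scope.

(* [Quat a b c d] stands for a + b i + c j + d k. *)
Record quat (R : Type) := Quat { qre : R; qi : R; qj : R; qk : R }.

Section QuatChoice.
Variable R : Type.

Definition quat_to_prod (x : quat R) : R * R * R * R :=
  (qre x, qi x, qj x, qk x).
Definition quat_of_prod (p : R * R * R * R) : quat R :=
  let: (a, b, c, d) := p in Quat a b c d.

Lemma quat_to_prodK : cancel quat_to_prod quat_of_prod.
Proof. by case. Qed.

End QuatChoice.

HB.instance Definition _ (R : choiceType) :=
  Choice.copy (quat R) (can_type (@quat_to_prodK R)).

Section QuatRing.
Variable R : comNzRingType.
Implicit Types x y z : quat R.

Definition addq x y :=
  Quat (qre x + qre y) (qi x + qi y) (qj x + qj y) (qk x + qk y).
Definition oppq x := Quat (- qre x) (- qi x) (- qj x) (- qk x).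
Definition zeroq : quat R := Quat 0 0 0 0.
Definition oneq : quat R := Quat 1 0 0 0.

(* Hamilton product: the bilinear extension of i^2 = j^2 = k^2 = ijk = -1. *)
Definition mulq x y :=
  let: Quat a b c d := x in
  let: Quat a' b' c' d' := y in
  Quat (a * a' - b * b' - c * c' - d * d')
       (a * b' + b * a' + c * d' - d * c')
       (a * c' - b * d' + c * a' + d * b')
       (a * d' + b * c' - c * b' + d * a').

Lemma addqA : associative addq.
Proof. by move=> [????] [????] [????]; congr Quat; rewrite /= addrA. Qed.

Lemma addqC : commutative addq.
Proof. by move=> [????] [????]; congr Quat; rewrite /= addrC. Qed.

Lemma add0q : left_id zeroq addq.
Proof. by move=> [????]; congr Quat; rewrite /= add0r. Qed.

Lemma addNq : left_inverse zeroq oppq addq.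
Proof. by move=> [????]; congr Quat; rewrite /= addNr. Qed.

HB.instance Definition _ :=
  GRing.isZmodule.Build (quat R) addqA addqC add0q addNq.

Lemma mulqA : associative mulq.
Proof. by move=> [????] [????] [????]; congr Quat; ring. Qed.

Lemma mul1q : left_id oneq mulq.
Proof. by move=> [????]; congr Quat; ring. Qed.

Lemma mulq1 : right_id oneq mulq.
Proof. by move=> [????]; congr Quat; ring. Qed.

Lemma mulqDl : left_distributive mulq addq.
Proof. by move=> [????] [????] [????]; congr Quat; rewrite /=; ring. Qed.

Lemma mulqDr : right_distributive mulq addq.
Proof. by move=> [????] [????] [????]; congr Quat; rewrite /=; ring. Qed.

Lemma oneq_neq0 : oneq != 0.
Proof. by apply/eqP => - [] /eqP; rewrite oner_eq0. Qed.

HB.instance Definition _ :=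
  GRing.Zmodule_isNzRing.Build (quat R) mulqA mul1q mulq1 mulqDl mulqDr
    oneq_neq0.

Definition iq : quat R := Quat 0 1 0 0.
Definition jq : quat R := Quat 0 0 1 0.
Definition kq : quat R := Quat 0 0 0 1.

Lemma hamilton_relations :
  [/\ iq * iq = -1, jq * jq = -1, kq * kq = -1 & iq * jq * kq = -1].
Proof. by split; congr Quat; rewrite /=; ring. Qed.

End QuatRing.

Section SkewInverse.
Variables (S : nzRingType) (n : nat).
Implicit Types A B Z : 'M[S]_n.

Definition skew_symmetric Z := Z^T = - Z.

(* [unitmx] and [invmx] are determinant-based and require a commutative
   coefficient ring, hence this relational form of B = A^-1. *)
Definition is_inverse A B := A *m B = 1%:M /\ B *m A = 1%:M.

Lemma is_inverse_uniq A B C : is_inverse A B -> is_inverse A C -> B = C.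
Proof.
by move=> [_ eqBA] [eqAC _]; rewrite -[B]mulmx1 -eqAC mulmxA eqBA mul1mx.
Qed.

End SkewInverse.

(* Main.v *)
(** Over a ring without zero divisors in which 2 <> 0, a skew-symmetric matrix
    has zero diagonal. If Z has upper entries a, b, c and W has upper entries
    x, y, z, both skew-symmetric, then the off-diagonal part of Z W = 1 gives
    a z = b z = a y = 0 and the diagonal part gives
    - a x - b y = - a x - c z = - b y - c z = 1. If z <> 0 then a = b = 0,
    against the first diagonal equation; if z = 0 then a and y are both
    nonzero, against a y = 0. *)
Require Import Defs.
From HB Require Import structures.
From mathcomp Require Import all_boot all_order all_algebra.
From mathcomp Require Import reals ring.

Import Order.TTheory GRing.Theory Num.Theory.
Local Open Scope ring_scope.

(** The reduced norm, i.e. x times its conjugate, kept as a scalar in [R] so that products can be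
    studied in a commutative ring. *)
Definition normq {R : comNzRingType} (x : quat R) : R :=
  qre x ^+ 2 + qi x ^+ 2 + qj x ^+ 2 + qk x ^+ 2.

(** Euler's four-square identity. *)
Lemma normqM {R : comNzRingType} (x y : quat R) :
  normq (x * y) = normq x * normq y.
Proof. by case: x y => [????] [????]; rewrite /normq /=; ring. Qed.

Lemma normq_eq0 {R : realDomainType} (x : quat R) : normq x = 0 -> x = 0.
Proof.
case: x => a b c d /eqP; rewrite /normq /= !paddr_eq0 ?addr_ge0 ?sqr_ge0 //.
by rewrite !sqrf_eq0 => /andP[/andP[/andP[/eqP-> /eqP->] /eqP->] /eqP->].
Qed.

(** The multiplicative norm moves the question to the domain [R]; a sum of squares vanishes there
    only termwise. *)
Lemma mulq_eq0 {R : realDomainType} (x y : quat R) :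
  x * y = 0 -> x = 0 \/ y = 0.
Proof.
move=> xy0; have /eqP : normq x * normq y = 0.
  by rewrite -normqM xy0 /normq /= expr0n /= !addr0.
by rewrite mulf_eq0 => /orP[] /eqP /normq_eq0 ->; [left | right].
Qed.

Lemma quat_two_neq0 {R : realDomainType} : (2 : quat R) <> 0.
Proof. by case=> /eqP; rewrite -mulr2n pnatr_eq0. Qed.

Section NoZeroDivisors.
Variable S : nzRingType.
Hypothesis mulS_eq0 : forall x y : S, x * y = 0 -> x = 0 \/ y = 0.
Hypothesis two_neq0 : (2 : S) <> 0.

Lemma skew_symmetricE {n} {Z : 'M[S]_n} (Zskew : skew_symmetric Z) i j :
  Z j i = - Z i j.
Proof. by have /matrixP/(_ i j) := Zskew; rewrite !mxE. Qed.

(** Skew-symmetry at (i, i) makes the entry its own opposite, and 2 can be cancelled. *)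
Lemma skew_symmetric_diag {n} {Z : 'M[S]_n} (Zskew : skew_symmetric Z) i :
  Z i i = 0.
Proof.
have Zii : 2 * Z i i = 0.
  by rewrite mulr_natl mulr2n {1}(skew_symmetricE Zskew) addNr.
by have [/two_neq0|] := mulS_eq0 _ _ Zii.
Qed.

Lemma skew_symmetric3_mulmx_neq1 (Z W : 'M[S]_3) :
  skew_symmetric Z -> skew_symmetric W -> Z *m W <> 1%:M.
Proof.
move=> Zskew Wskew /matrixP ZW1.
pose i0 : 'I_3 := ord0; pose i1 : 'I_3 := lift ord0 ord0.
pose i2 : 'I_3 := lift ord0 (lift ord0 ord0).
have ZW i j : Z i i0 * W i0 j + Z i i1 * W i1 j + Z i i2 * W i2 j = (i == j)%:R.
  by have := ZW1 i j; rewrite !mxE !big_ord_recl big_ord0 addr0 addrA.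
have Z0 := skew_symmetric_diag Zskew; have W0 := skew_symmetric_diag Wskew.
have oppW := skew_symmetricE Wskew; have oppZ := skew_symmetricE Zskew.
(* In an off-diagonal entry of Z W the zero diagonals kill two of the three products: the entries
   (0,1), (0,2), (1,2) are - b z, a z, - a y. *)
have bz : Z i0 i2 * W i1 i2 = 0.
  move: (ZW i0 i1); rewrite Z0 W0 mul0r mulr0 !add0r (oppW i1 i2) mulrN.
  by move/eqP; rewrite oppr_eq0 => /eqP.
have az : Z i0 i1 * W i1 i2 = 0.
  by move: (ZW i0 i2); rewrite Z0 W0 mul0r mulr0 add0r addr0.
have ay : Z i0 i1 * W i0 i2 = 0.
  move: (ZW i1 i2); rewrite Z0 W0 mul0r mulr0 !addr0 (oppZ i0 i1) mulNr.
  by move/eqP; rewrite oppr_eq0 => /eqP.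
have d0 := ZW i0 i0; have d1 := ZW i1 i1; have d2 := ZW i2 i2.
have one_neq0 : (0 : S) <> 1 by move/esym/eqP; rewrite oner_eq0.
have [z0|z_neq0] := eqVneq (W i1 i2) 0.
  (* For z = 0 the diagonal entries (1,1) and (2,2) shrink to - a x and - b y, so either alternative
     gives 0 = 1. *)
  have [a0|y0] := mulS_eq0 _ _ ay; apply: one_neq0.
    by move: d1; rewrite (oppZ i0 i1) a0 oppr0 Z0 (oppW i1 i2) z0 oppr0
                         mulr0 !mul0r !addr0.
  by move: d2; rewrite y0 z0 W0 !mulr0 !addr0.
have nz : W i1 i2 <> 0 by apply/eqP.
have [a0|//] := mulS_eq0 _ _ az; have [b0|//] := mulS_eq0 _ _ bz.
by apply: one_neq0; move: d0; rewrite Z0 a0 b0 !mul0r !addr0.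
Qed.

End NoZeroDivisors.

Theorem proposition5p1 (R : realType) (Z : 'M[quat R]_3)
    (Zskew : skew_symmetric Z) (Zinv : 'M[quat R]_3)
    (ZinvP : is_inverse Z Zinv) :
  ~ skew_symmetric Zinv.
Proof.
move=> Wskew; have [ZW1 _] := ZinvP.
exact: (skew_symmetric3_mulmx_neq1 _ mulq_eq0 quat_two_neq0 _ _ Zskew Wskew ZW1).
Qed.
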